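(* Let $M\in\mathbb{R}^{d\times d}$ be symmetric, let $f:\mathbb{R}^d\to\mathbb{R}$ be differentiable and $M$-matrix-smooth, and let $\bar z$ be a stationary point of $f$. Let $s$ be standardized on $\mathbb{R}^d$ with $\mathbb{E}[\mathsf{u}_i^4]=\kappa<\infty$, and for $w=(m,C)$ let $\mathsf{g}=\nabla_w f(T_w(\mathsf{u}))$ with $\mathsf{u}\sim s$. Then \[ \mathbb{E}\|\mathsf{g}\|_2^2\le (d+1)\|M(m-\bar z)\|_2^2+(d+\kappa)\|MC\|_F^2 . \] Moreover, the bound is unimprovable: for every symmetric $M$ and every $\bar z$, the function $f(z)=\frac12(z-\bar z)^\top M(z-\bar z)$ satisfies the hypotheses and attains equality for every $w=(m,C)$.
   Context: For a symmetric matrix $M$, $f$ is $M$-matrix-smooth if $\|\nabla f(y)-\nabla f(z)\|_2\le\|M(y-z)\|_2$ for all $y,z\in\mathbb{R}^d$. $T_w(u)=Cu+m$ for $w=(m,C)$, $m\in\mathbb{R}^d$, $C\in\mathbb{R}^{d\times d}$, with $w$ regarded as the vector of all $d+d^2$ entries; $\nabla_w$ is the gradient with respect to all these entries and its norm is the Euclidean norm over all entries. A distribution $s$ on $\mathbb{R}^d$ is standardized if for $\mathsf{u}\sim s$ the components are i.i.d. with $\mathbb{E}\mathsf{u}_1=\mathbb{E}\mathsf{u}_1^3=0$ and $\mathrm{Var}(\mathsf{u}_1)=1$. $\|\cdot\|_F$ is the Frobenius norm. *)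

(* Defs.v *)
From HB Require Import structures.
From mathcomp Require Import all_boot all_order all_algebra.
From mathcomp Require Import all_classical all_reals all_analysis.
Set Implicit Arguments.
Unset Strict Implicit.
Unset Printing Implicit Defensive.
Import Order.TTheory GRing.Theory Num.Theory.
Import numFieldNormedType.Exports.
Local Open Scope classical_set_scope.
Local Open Scope ring_scope.

Section defs.
Variables (R : realType) (d : nat).

Definition norm2 (v : 'cV[R]_d) : R := Num.sqrt (\sum_i (v i 0) ^+ 2).

Definition frob (A : 'M[R]_d) : R := Num.sqrt (\sum_i \sum_j (A i j) ^+ 2).

Definition grad (f : 'cV[R]_d -> R) (z : 'cV[R]_d) : 'cV[R]_d :=
  \col_i derive f z (delta_mx i 0 : 'cV[R]_d).

Definition matrix_smooth (M : 'M[R]_d) (f : 'cV[R]_d -> R) : Prop :=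
  forall y z : 'cV[R]_d, norm2 (grad f y - grad f z) <= norm2 (M *m (y - z)).

Definition Tw (m : 'cV[R]_d) (C : 'M[R]_d) (u : 'cV[R]_d) : 'cV[R]_d :=
  C *m u + m.

Definition grad_m (f : 'cV[R]_d -> R) (m : 'cV[R]_d) (C : 'M[R]_d)
  (u : 'cV[R]_d) : 'cV[R]_d :=
  \col_i derive (fun m' : 'cV[R]_d => f (Tw m' C u)) m (delta_mx i 0 : 'cV[R]_d).

Definition grad_C (f : 'cV[R]_d -> R) (m : 'cV[R]_d) (C : 'M[R]_d)
  (u : 'cV[R]_d) : 'M[R]_d :=
  \matrix_(i, j) derive (fun C' : 'M[R]_d => f (Tw m C' u)) C (delta_mx i j : 'M[R]_d).

Definition gradw_norm (f : 'cV[R]_d -> R) (m : 'cV[R]_d) (C : 'M[R]_d)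
  (u : 'cV[R]_d) : R :=
  Num.sqrt (\sum_i (grad_m f m C u i 0) ^+ 2 +
            \sum_i \sum_j (grad_C f m C u i j) ^+ 2).

Definition quad (M : 'M[R]_d) (zbar : 'cV[R]_d) (z : 'cV[R]_d) : R :=
  2^-1 * (((z - zbar)^T *m M *m (z - zbar)) 0 0).

End defs.

Section random.
Variables (dd : measure_display) (T : measurableType dd) (R : realType)
  (P : probability T R) (d : nat).

Definition rvec (u : 'I_d -> {RV P >-> R}) (w : T) : 'cV[R]_d :=
  \col_i u i w.

Definition mutually_independent (u : 'I_d -> {RV P >-> R}) : Prop :=
  forall B : 'I_d -> set R, (forall i, measurable (B i)) ->
    P (\bigcap_i (u i @^-1` B i)) = (\prod_i P (u i @^-1` B i))%E.

Definition identically_distributed (u : 'I_d -> {RV P >-> R}) : Prop :=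
  forall (i j : 'I_d) (B : set R), measurable B ->
    P (u i @^-1` B) = P (u j @^-1` B).

(* the law of u is standardized with E[u_i^4] = kappa (finite, as kappa : R) *)
Definition standardized_kappa (u : 'I_d -> {RV P >-> R}) (kappa : R) : Prop :=
  [/\ mutually_independent u, identically_distributed u &
    forall i : 'I_d,
      [/\ ('E_P[u i] = 0)%E, ('E_P[fun w => (u i w ^+ 3)%R] = 0)%E,
          ('V_P[u i] = 1)%E & ('E_P[fun w => (u i w ^+ 4)%R] = kappa%:E)%E]].

End random.

(* Main.v *)
(* With z = T_w(u), the chain rule gives nabla_m = grad f(z) and
   nabla_C = grad f(z) u^T, so |g|^2 = (1 + |u|^2) |grad f(z)|^2.  Smoothness at
   the stationary point bounds |grad f(z)|^2 by |a + B u|^2 with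
   a = M (m - zbar) and B = M C, with equality when f is the quadratic.  It
   remains to evaluate E[(1 + |u|^2) |a + B u|^2]: expanding into monomials,
   independence and the vanishing first and third moments leave only
   (d + 1) |a|^2 + (d + kappa) |B|_F^2. *)
Require Import Defs.
From HB Require Import structures.
From mathcomp Require Import all_boot all_order all_algebra.
From mathcomp Require Import all_classical all_reals all_analysis.
From mathcomp Require Import measurable_realfun ring.
Import Order.TTheory GRing.Theory Num.Theory.
Import numFieldNormedType.Exports.
Local Open Scope ring_scope.
Local Open Scope classical_set_scope.
Set Implicit Arguments.
Unset Strict Implicit.
Unset Printing Implicit Defensive.

(* Unlike ge0_le_integral, no measurability is required: the integral of a
   nonnegative function is a supremum over the simple functions below it. *)
Lemma ge0_le_integralT {dd : measure_display} {T : measurableType dd}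
    {R : realType} (mu : {measure set T -> \bar R}) (f g : T -> \bar R) :
  (forall x, 0 <= f x)%E -> (forall x, f x <= g x)%E ->
  (\int[mu]_x f x <= \int[mu]_x g x)%E.
Proof.
move=> f0 fg; have g0 x : (0 <= g x)%E by exact: le_trans (f0 x) (fg x).
rewrite !ge0_integralTE//; apply: ereal_sup_le => _ [h /= hf <-].
by exists h => // x; exact: le_trans (hf x) (fg x).
Qed.

(** * Means of real random variables *)

Section mean.
Context {dd : measure_display} {T : measurableType dd} {R : realType}.
Variable P : probability T R.
Implicit Types (X Y Z : T -> R) (r s c : R).

(** Integrability is bundled with the value, so that linearity of the mean carries no side
    conditions and values stay in [R] rather than in the extended reals. *)
Definition has_mean (X : T -> R) (r : R) : Prop :=
  P.-integrable setT (EFin \o X) /\ (\int[P]_w (X w)%:E = r%:E)%E.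

Lemma has_mean_inj X r s : has_mean X r -> has_mean X s -> r = s.
Proof. by move=> [_ Xr] [_]; rewrite Xr => -[]. Qed.

Lemma eq_has_mean X Y r : X =1 Y -> has_mean X r -> has_mean Y r.
Proof. by move=> /funext ->. Qed.

Lemma has_mean_cst r : has_mean (fun=> r) r.
Proof.
split; first exact: finite_measure_integrable_cst.
by rewrite -[RHS](expectation_cst P) unlock.
Qed.

Lemma has_meanD X Y r s : has_mean X r -> has_mean Y s ->
  has_mean (fun w => X w + Y w) (r + s).
Proof.
move=> [iX Xr] [iY Ys]; split; first exact: integrableD iX iY.
under eq_integral do rewrite EFinD.
by rewrite integralD// Xr Ys.
Qed.

Lemma has_meanZ a X r : has_mean X r -> has_mean (fun w => a * X w) (a * r).
Proof.
move=> [iX Xr]; split; first exact: (integrableZl measurableT a iX).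
under eq_integral do rewrite EFinM.
by rewrite integralZl// Xr.
Qed.

Lemma has_meanB X Y r s : has_mean X r -> has_mean Y s ->
  has_mean (fun w => X w - Y w) (r - s).
Proof.
move=> HX /(has_meanZ (-1)); rewrite mulN1r => /(has_meanD HX).
by apply: eq_has_mean => w; rewrite mulN1r.
Qed.

Lemma has_mean_sum (I : Type) (s : seq I) (X : I -> T -> R) (r : I -> R) :
  (forall i, has_mean (X i) (r i)) ->
  has_mean (fun w => \sum_(i <- s) X i w) (\sum_(i <- s) r i).
Proof.
move=> Xr; elim: s => [|i s IH].
  by rewrite big_nil; apply: eq_has_mean (has_mean_cst 0) => w; rewrite big_nil.
rewrite big_cons; apply: eq_has_mean (has_meanD (Xr i) IH) => w.
by rewrite big_cons.
Qed.

Lemma ge0_has_mean X r : measurable_fun setT X -> (forall w, 0 <= X w) ->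
  (\int[P]_w (X w)%:E = r%:E)%E -> has_mean X r.
Proof.
move=> mX X0 Xr; split=> //; apply/integrableP; split.
  exact/measurable_EFinP.
under eq_integral do rewrite /= ger0_norm//.
by rewrite Xr ltry.
Qed.

Lemma has_mean_dominated X Y r : measurable_fun setT X ->
  (forall w, `|X w| <= Y w) -> has_mean Y r -> exists s, has_mean X s.
Proof.
move=> mX XY [iY _].
have iX : P.-integrable setT (EFin \o X).
  apply: le_integrable iY => //; first exact/measurable_EFinP.
  by move=> w _ /=; rewrite lee_fin (le_trans (XY w))// ler_norm.
exists (fine (\int[P]_w (X w)%:E)); split => //; rewrite fineK//.
exact: integrable_fin_num.
Qed.

Lemma has_mean_norm X : P.-integrable setT (EFin \o X) ->
  exists s, has_mean (fun w => `|X w|) s.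
Proof.
move=> /integrable_norm iX; exists (fine (\int[P]_w (`|X w|)%:E)); split => //.
by rewrite fineK//; exact: integrable_fin_num.
Qed.

Import HBNNSimple.

(** Factorization passes from indicators of [X] to simple functions of [X] by linearity, then to
    [phi] by monotone convergence. It serves to replace one indicator by a general function in a
    product of independent factors. *)
Lemma ge0_integral_factor (X Z : T -> R) (c : R) :
  measurable_fun setT X -> measurable_fun setT Z -> (forall w, 0 <= Z w) ->
  (forall B : set R, measurable B ->
    \int[P]_w (\1_B (X w) * Z w)%:E = \int[P]_w (\1_B (X w))%:E * c%:E)%E ->
  forall phi : R -> R, measurable_fun setT phi -> (forall x, 0 <= phi x) ->
    (\int[P]_w (phi (X w) * Z w)%:E = \int[P]_w (phi (X w))%:E * c%:E)%E.
Proof.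
move=> mX mZ Z0 XZ phi mphi phi0.
have mphiE : measurable_fun setT (EFin \o phi) by exact/measurable_EFinP.
pose h := nnsfun_approx measurableT mphiE.
have cvgh x : (fun n => (h n x)%:E) @ \oo --> (phi x)%:E.
  by apply: (cvg_nnsfun_approx measurableT mphiE) => // y _; rewrite lee_fin.
have ndh x : {homo (fun n => h n x) : n m / (n <= m)%N >-> n <= m}.
  by move=> n m nm; exact/lefP/nd_nnsfun_approx.
have mh n : measurable_fun setT (fun w => h n (X w)).
  by apply: measurableT_comp.
(* Stated for a general weight [W] because it is applied to both sides of the identity: [W = Z] on
   the left and [W = 1] on the right. *)
have key (W : T -> R) : measurable_fun setT W -> (forall w, 0 <= W w) ->
    (fun n => \int[P]_w (h n (X w) * W w)%:E)%E @ \oo -->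
    (\int[P]_w (phi (X w) * W w)%:E)%E.
  move=> mW W0.
  have -> : (\int[P]_w (phi (X w) * W w)%:E =
      \int[P]_w limn (fun n => (h n (X w) * W w)%:E))%E.
    apply: eq_integral => w _; apply/esym/cvg_lim => //.
    rewrite EFinM; under eq_fun do rewrite EFinM.
    by apply: cvgeZr.
  apply: cvg_monotone_convergence => //.
  - move=> n; apply/measurable_EFinP; exact: measurable_funM.
  - by move=> n w _; rewrite lee_fin mulr_ge0.
  - by move=> w _ n m nm; rewrite lee_fin ler_wpM2r// ndh.
have kZ := key _ mZ Z0.
have k1 := key (fun=> 1) (measurable_cst _) (fun=> ler01).
have suf n : (\int[P]_w (h n (X w) * Z w)%:E =
    \int[P]_w (h n (X w) * 1)%:E * c%:E)%E.
  (* Split the simple function [h n] along its level sets, on whose indicators the hypothesis [XZ]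
     applies. *)
  have fs (W : T -> R) : measurable_fun setT W -> (forall w, 0 <= W w) ->
    (\int[P]_w (h n (X w) * W w)%:E = \sum_(y \in range (h n))
      y%:E * \int[P]_w (\1_(h n @^-1` [set y]) (X w) * W w)%:E)%E.
    move=> mW W0.
    transitivity (\int[P]_w (\sum_(y \in range (h n))
        (y * (\1_(h n @^-1` [set y]) (X w) * W w))%:E))%E.
      apply: eq_integral => w _; rewrite fsumEFin// fimfunE; congr EFin.
      rewrite !fsbig_finite//= mulr_suml.
      by apply: eq_bigr => y _; rewrite mulrA.
    have mi y : measurable_fun setT (fun w => \1_(h n @^-1` [set y]) (X w) * W w).
      by apply: measurable_funM => //; apply: measurableT_comp.
    rewrite ge0_integral_fsum//.
    - apply: eq_fsbigr => y /[!inE] -[x _ <-].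
      under eq_integral do rewrite EFinM.
      rewrite ge0_integralZl_EFin//.
      + by move=> w _; rewrite lee_fin mulr_ge0.
      + exact/measurable_EFinP.
    - by move=> y; apply/measurable_EFinP/measurable_funM.
    - move=> y w _; rewrite lee_fin mulrA mulr_ge0//.
      by rewrite -lee_fin nnfun_muleindic_ge0.
  rewrite !fs// !fsbig_finite//= ge0_sume_distrl; last first.
    (* Distributivity in the extended reals needs nonnegative terms. For [y < 0] the level set is
       empty, since [h n] is nonnegative, and the term is zero. *)
    move=> y _; have [y0|y0] := leP 0 y.
      by rewrite mule_ge0 ?lee_fin// integral_ge0// => w _; rewrite lee_fin mulr1.
    rewrite integral0_eq ?mule0// => w _; rewrite indicE memNset ?mul0r//= => hy.
    by move: y0; rewrite -hy ltNge fun_ge0.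
  apply: eq_bigr => y _; rewrite XZ// muleA; congr (_ * _ * _)%E.
  by apply: eq_integral => w _; rewrite mulr1.
rewrite -(cvg_lim _ kZ)//.
under eq_fun do rewrite suf.
apply/cvg_lim => //; apply: cvgeZr => //.
by under [X in _ --> X]eq_integral do rewrite -[X in X%:E]mulr1.
Qed.
End mean.

(** * Means of products of independent variables *)

Section independent.
Context {dd : measure_display} {T : measurableType dd} {R : realType}.
Variables (P : probability T R) (d : nat) (u : 'I_d -> {RV P >-> R}).
Hypothesis indep_u : mutually_independent u.
Implicit Types (phi : 'I_d -> R -> R) (r : 'I_d -> R).

Lemma ge0_has_mean_prod phi r : (forall i, measurable_fun setT (phi i)) ->
  (forall i x, 0 <= phi i x) ->
  (forall i, has_mean P (phi i \o u i) (r i)) ->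
  has_mean P (fun w => \prod_i phi i (u i w)) (\prod_i r i).
Proof.
move=> mphi phi0 phir.
have mprod (psi : 'I_d -> R -> R) : (forall i, measurable_fun setT (psi i)) ->
    forall s : seq 'I_d, measurable_fun setT (fun w => \prod_(i <- s) psi i (u i w)).
  by move=> mpsi s; apply: measurable_prod => i _; apply: measurableT_comp.
apply: ge0_has_mean; [exact: mprod|by move=> w; exact: prodr_ge0|].
(* Induction on the number of coordinates where phi i is not an indicator. *)
suff H n : forall phi r, (forall i, measurable_fun setT (phi i)) ->
    (forall i x, 0 <= phi i x) ->
    (forall i, (\int[P]_w (phi i (u i w))%:E = (r i)%:E)%E) ->
    (forall i : 'I_d, (n <= i)%N ->
       exists2 B : set R, measurable B & phi i = \1_B) ->
    (\int[P]_w (\prod_i phi i (u i w))%:E = (\prod_i r i)%:E)%E.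
  apply: (H d) => // i; first by case: (phir i).
  by rewrite leqNgt ltn_ord.
elim: n => [|n IH] {mphi phi0 phir} {}phi {}r mphi phi0 phir phiB.
  have {}phiB i : {B : set R | measurable B & phi i = \1_B}.
    by apply/cid2; exact: phiB.
  pose B i := s2val (phiB i).
  have mB i : measurable (B i) := s2valP (phiB i).
  have phiE i : phi i = \1_(B i) := s2valP' (phiB i).
  (* When all factors are indicators, their product is the indicator of an intersection, and the
     claim is the definition of independence. *)
  transitivity (\int[P]_w (\1_(\bigcap_i (u i @^-1` B i)) w)%:E)%E.
    apply: eq_integral => w _; congr EFin; rewrite indicE.
    have [wB|wB] := pselect ((\bigcap_i (u i @^-1` B i)) w).
      rewrite (mem_set wB).
      by rewrite big1// => i _; rewrite phiE indicE mem_set//; exact: wB.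
    rewrite (memNset wB).
    have [i wBi] : exists i, ~ B i (u i w).
      by apply/existsNP => wBi; apply: wB => i _; exact: wBi.
    by rewrite (bigD1 i)//= phiE indicE memNset// mul0r.
  have mBi i : measurable (u i @^-1` B i) by exact: measurable_funPTI.
  rewrite integral_indic//; last first.
    by apply: fin_bigcap_measurable => //; exact: finite_finset.
  rewrite setIT; transitivity (\prod_i P (u i @^-1` B i))%E; first exact: indep_u.
  rewrite -prodEFin; apply: eq_bigr => i _.
  by rewrite -phir phiE (integral_indic P measurableT (mBi i)) setIT.
(* If [d <= n] there is no coordinate of index [n], and the condition of the induction hypothesis is
   vacuous. *)
have [nd|] := ltnP n d; last first.
  move=> dn; apply: IH => // i ni.
  by have := leq_trans (leq_trans (ltn_ord i) dn) ni; rewrite ltnn.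
pose i0 := Ordinal nd.
rewrite (bigD1 i0)//= EFinM -phir.
under eq_integral do rewrite (bigD1 i0)//=.
apply: (@ge0_integral_factor _ _ _ P (u i0)
   (fun w => \prod_(i < d | i != i0) phi i (u i w))) => //.
- have -> : (fun w => \prod_(i < d | i != i0) phi i (u i w)) =
    (fun w => \prod_(i < d) if i == i0 then 1 else phi i (u i w)).
    by apply/funext => w; rewrite big_mkcond/=; apply: eq_bigr => i _; case: eqP.
  by apply: measurable_prod => i _; case: eqP => // _; apply: measurableT_comp.
- by move=> w; apply: prodr_ge0.
move=> B mB.
(* With [\1_B] at coordinate [n], every coordinate from [n] on is an indicator, so the induction
   hypothesis gives the factorization that [ge0_integral_factor] asks for. *)
pose phi' i := if i == i0 then \1_B : R -> R else phi i.
pose r' i := if i == i0 then fine (\int[P]_w (\1_B (u i0 w))%:E) else r i.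
have finB : (\int[P]_w (\1_B (u i0 w))%:E)%E \is a fin_num.
  have mBu : measurable (u i0 @^-1` B) by exact: measurable_funPTI.
  by rewrite (integral_indic P measurableT mBu) fin_num_measure// setIT.
have : (\int[P]_w (\prod_i phi' i (u i w))%:E = (\prod_i r' i)%:E)%E.
  apply: IH; rewrite /phi' /r'.
  - by move=> i; case: eqP => // _; exact: mphi.
  - by move=> i x; case: eqP => // _; exact: phi0.
  - by move=> i; case: eqP => [->|//]; rewrite fineK.
  - move=> i ni; case: eqP => [_|/eqP ii0]; first by exists B.
    by apply: phiB; rewrite ltn_neqAle ni andbT eq_sym.
rewrite (bigD1 i0)//= {1}/r' eqxx EFinM fineK//.
have -> : \prod_(i < d | i != i0) r' i = \prod_(i < d | i != i0) r i.
  by apply: eq_bigr => i /negPf ii0; rewrite /r' ii0.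
move=> <-; apply: eq_integral => w _; rewrite [in RHS](bigD1 i0)//= {1}/phi' eqxx.
by congr (_ * _)%:E; apply: eq_bigr => i /negPf; rewrite /phi' => ->.
Qed.

Lemma has_mean_prod phi r : (forall i, measurable_fun setT (phi i)) ->
  (forall i, has_mean P (phi i \o u i) (r i)) ->
  has_mean P (fun w => \prod_i phi i (u i w)) (\prod_i r i).
Proof.
(* Induction on the number of coordinates where phi i may change sign, splitting
   one of them into its positive and negative parts. *)
suff H n : forall phi r, (forall i, measurable_fun setT (phi i)) ->
    (forall i, has_mean P (phi i \o u i) (r i)) ->
    (forall i : 'I_d, (n <= i)%N -> forall x, 0 <= phi i x) ->
    has_mean P (fun w => \prod_i phi i (u i w)) (\prod_i r i).
  by move=> mphi phir; apply: (H d) => // i; rewrite leqNgt ltn_ord.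
elim: n => [|n IH] {}phi {}r mphi phir phi0.
  by apply: ge0_has_mean_prod => // i x; exact: phi0.
have [nd|] := ltnP n d; last first.
  move=> dn; apply: IH => // i ni.
  by have := leq_trans (leq_trans (ltn_ord i) dn) ni; rewrite ltnn.
pose i0 := Ordinal nd.
(* [part false] is the positive part of [phi i0] and [part true] the negative part; both are
   dominated by its absolute value, hence have means. *)
pose part (b : bool) x := Num.max ((-1) ^+ b * phi i0 x) 0.
have part_sub x : part false x - part true x = phi i0 x.
  rewrite /part expr0 expr1 mul1r mulN1r !maxEle oppr_le0.
  by case: ltgtP => [_|_|->]; rewrite ?oppr0 ?addr0 ?sub0r ?opprK.
have mpart b : measurable_fun setT (part b).
  by apply: measurable_maxr => //; apply: measurable_funM.
have part0 b x : 0 <= part b x by rewrite le_max lexx orbT.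
have mean_abs : exists s, has_mean P (fun w => `|phi i0 (u i0 w)|) s.
  by case: (phir i0) => i_phi _; exact: has_mean_norm i_phi.
have /all_sig[s Hs] b : {s | has_mean P (part b \o u i0) s}.
  apply/cid; case: mean_abs => s; apply: has_mean_dominated.
    exact: measurableT_comp.
  move=> w /=; rewrite ger0_norm// /part ge_max normr_ge0 andbT.
  by rewrite (le_trans (ler_norm _))// normrM normrX normrN1 expr1n mul1r.
have rE : r i0 = s false - s true.
  apply: has_mean_inj (phir i0) _.
  by apply: eq_has_mean (has_meanB (Hs false) (Hs true)) => w /=.
pose phi' b i := if i == i0 then part b else phi i.
pose r' b i := if i == i0 then s b else r i.
have {}IH b : has_mean P (fun w => \prod_i phi' b i (u i w)) (\prod_i r' b i).
  apply: IH; rewrite /phi' /r'.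
  - by move=> i; case: eqP => // _; exact: mphi.
  - by move=> i; case: eqP => [->|].
  - move=> i ni x; case: eqP => [//|/eqP ii0].
    by apply: phi0; rewrite ltn_neqAle ni andbT eq_sym.
(* The two products differ only at [i0], so the remaining factors come out of the difference. *)
have -> : \prod_i r i = \prod_i r' false i - \prod_i r' true i.
  have D b : \prod_i r' b i = s b * \prod_(i < d | i != i0) r i.
    rewrite (bigD1 i0)//= {1}/r' eqxx; congr (_ * _).
    by apply: eq_bigr => i /negPf; rewrite /r' => ->.
  by rewrite !D -mulrBl -rE (bigD1 i0).
apply: eq_has_mean (has_meanB (IH false) (IH true)) => w.
have D b : \prod_i phi' b i (u i w) =
    part b (u i0 w) * \prod_(i < d | i != i0) phi i (u i w).
  rewrite (bigD1 i0)//= {1}/phi' eqxx; congr (_ * _).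
  by apply: eq_bigr => i /negPf; rewrite /phi' => ->.
by rewrite !D -mulrBl part_sub [RHS](bigD1 i0).
Qed.

End independent.

(** * Moments of a standardized vector *)

Section moments.
Context {dd : measure_display} {T : measurableType dd} {R : realType}.
Variables (P : probability T R) (d : nat) (u : 'I_d -> {RV P >-> R}).
Variable kappa : R.
Hypothesis std_u : standardized_kappa u kappa.

(* Meaningful for k <= 4 only: every k >= 4 gives kappa. *)
Definition std_moment (k : nat) : R := nth kappa [:: 1; 0; 1; 0] k.

Lemma has_mean_std_moment i k : (k <= 4)%N ->
  has_mean P (fun w => u i w ^+ k) (std_moment k).
Proof.
case: std_u => _ _ /(_ i)[E1 E3 E2 E4].
have mX n : measurable_fun setT (fun w => u i w ^+ n).
  exact: measurable_funX.
have mean4 : has_mean P (fun w => u i w ^+ 4) kappa.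
  apply: ge0_has_mean => //; first by move=> w; rewrite exprn_even_ge0.
  by rewrite -E4 unlock.
rewrite leq_eqVlt => /predU1P[->//|k4].
(* Integrability of the lower powers comes from the fourth moment, through [|x|^k <= 1 + x^4] for
   [k < 4]. *)
have [s ms] : exists s, has_mean P (fun w => u i w ^+ k) s.
  apply: has_mean_dominated (has_meanD (has_mean_cst P 1) mean4) => // w.
  rewrite normrX -[u i w ^+ 4]ger0_norm ?exprn_even_ge0// normrX.
  have [x1|x1] := leP `|u i w| 1.
    by rewrite ler_wpDr ?exprn_ge0// exprn_ile1.
  by rewrite ler_wpDl// ler_weXn2l ?(ltW x1)// ltnW.
suff <- : s = std_moment k by [].
case: ms => _; move: k4; rewrite /std_moment.
case: k => [_|[_|[_|[_|//]]]] /= => [||h|].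
- by have [_ ->] := has_mean_cst P (1 : R) => -[].
- by move: E1; rewrite unlock => -> -[].
(* The mean being zero, the variance is the raw second moment. *)
- move: E2; rewrite /variance unlock E1 /= => E2.
  apply: EFin_inj; rewrite -h -E2 unlock.
  by apply: eq_integral => w _ /=; rewrite !mulrfctE /= !subr0.
- by move: E3; rewrite unlock => -> -[].
Qed.

Lemma has_mean_monomial (e : 'I_d -> nat) : (forall i, (e i <= 4)%N) ->
  has_mean P (fun w => \prod_i u i w ^+ e i) (\prod_i std_moment (e i)).
Proof.
move=> e4; case: std_u => indep_u _ _.
apply: (has_mean_prod indep_u (phi := fun i x => x ^+ e i)).
  by move=> i; exact: measurable_funX.
by move=> i; exact: has_mean_std_moment.
Qed.

(** Lets a monomial in a few chosen coordinates be written as a product over all coordinates, the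
    form of [has_mean_monomial]; coinciding indices just add up in the exponents. *)
Lemma prodr_delta (x : 'I_d -> R) k : \prod_i x i ^+ (i == k) = x k.
Proof.
rewrite (bigD1 k)//= eqxx expr1 big1 ?mulr1// => i /negPf ->.
by rewrite expr0.
Qed.

Lemma has_mean_cross k l :
  has_mean P (fun w => u k w * u l w) (k == l)%:R.
Proof.
have -> : (k == l)%:R = \prod_i std_moment ((i == k) + (i == l)).
  have [<-|kl] := eqVneq k l.
    by rewrite big1// => i _; case: (i == k).
  by rewrite (bigD1 k)//= eqxx (negPf kl) mul0r.
apply: eq_has_mean (has_mean_monomial (e := fun i => (i == k) + (i == l))%N _).
  move=> w; under eq_bigr do rewrite exprD.
  by rewrite big_split/= !prodr_delta.
by move=> i; case: (i == k); case: (i == l).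
Qed.

(** Coordinate [k] has exponent 1 if [j != k] and 3 if [j = k]; both moments vanish. *)
Lemma has_mean_sqr_linear j k :
  has_mean P (fun w => u j w ^+ 2 * u k w) 0.
Proof.
have -> : 0 = \prod_i std_moment ((i == j) * 2 + (i == k)).
  by rewrite (bigD1 k)//= eqxx; case: (k == j); rewrite mul0r.
apply: eq_has_mean
  (has_mean_monomial (e := fun i => (i == j) * 2 + (i == k))%N _).
  move=> w; under eq_bigr do rewrite exprD exprM.
  by rewrite big_split/= prodrXl !prodr_delta.
by move=> i; case: (i == j); case: (i == k).
Qed.

(** If [k != l], coordinate [k] has exponent 1 or 3 and its moment kills the product. If [k = l],
    the exponents are either a single 4, giving [kappa], or two 2s, giving 1. *)
Lemma has_mean_sqr_cross j k l :
  has_mean P (fun w => u j w ^+ 2 * (u k w * u l w))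
    ((k == l)%:R * (if j == k then kappa else 1)).
Proof.
have -> : (k == l)%:R * (if j == k then kappa else 1) =
    \prod_i std_moment ((i == j) * 2 + ((i == k) + (i == l))).
  have [<-|kl] := eqVneq k l; last first.
    rewrite mul0r (bigD1 k)//= eqxx (negPf kl).
    by case: (k == j); rewrite mul0r.
  rewrite mul1r; have [->|jk] := eqVneq j k.
    rewrite (bigD1 k)//= eqxx big1 ?mulr1// => i /negPf ->//.
  rewrite big1// => i _; have [->|_] := eqVneq i j.
    by rewrite (negPf jk).
  by case: (i == k).
apply: eq_has_mean (has_mean_monomial
  (e := fun i => (i == j) * 2 + ((i == k) + (i == l)))%N _).
  move=> w; under eq_bigr do rewrite !exprD exprM.
  by rewrite big_split/= prodrXl big_split/= !prodr_delta.
by move=> i; case: (i == j); case: (i == k); case: (i == l).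
Qed.

(** Under the weight [V] the linear terms of the expanded square have mean zero and the quadratic
    ones survive only on the diagonal, with value [c]. It is applied to each row of [a + B u] with
    [V = 1 + |u|^2]. *)
Lemma has_mean_weighted_affine_sqr (V : T -> R) v c (a : R) (b : 'I_d -> R) :
  has_mean P V v ->
  (forall l, has_mean P (fun w => V w * u l w) 0) ->
  (forall k l, has_mean P (fun w => V w * (u k w * u l w)) ((k == l)%:R * c)) ->
  has_mean P (fun w => V w * (a + \sum_l b l * u l w) ^+ 2)
    (v * a ^+ 2 + c * \sum_l b l ^+ 2).
Proof.
move=> mV mVu mVuu.
have M1 := has_meanZ (a ^+ 2) mV.
have M2 := has_meanZ (2 * a) (has_mean_sum (index_enum 'I_d)
  (fun l => has_meanZ (b l) (mVu l))).
have M3 := has_mean_sum (index_enum 'I_d) (fun k =>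
  has_mean_sum (index_enum 'I_d) (fun l => has_meanZ (b k * b l) (mVuu k l))).
have := has_meanD M1 (has_meanD M2 M3).
have -> : v * a ^+ 2 + c * \sum_l b l ^+ 2 = a ^+ 2 * v +
    (2 * a * (\sum_(i <- index_enum 'I_d) b i * 0) +
     \sum_(i <- index_enum 'I_d) \sum_(j <- index_enum 'I_d)
       b i * b j * ((i == j)%:R * c)).
  rewrite mulrC; congr (_ + _).
  rewrite [X in 2 * a * X]big1 ?mulr0 ?add0r; last by move=> i _; rewrite mulr0.
  rewrite mulr_sumr; apply: eq_bigr => k _.
  rewrite (bigD1 k)//= eqxx big1; last first.
    by move=> l lk; rewrite eq_sym (negPf lk) mul0r mulr0.
  by rewrite addr0 mul1r mulrC.
apply: eq_has_mean => w; set S := \sum_l b l * u l w.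
have -> : \sum_(i <- index_enum 'I_d) b i * (V w * u i w) = V w * S.
  by rewrite mulr_sumr; apply: eq_bigr => i _; rewrite mulrCA.
have -> : \sum_(i <- index_enum 'I_d) \sum_(j <- index_enum 'I_d)
   b i * b j * (V w * (u i w * u j w)) = V w * (S * S).
  rewrite mulr_suml mulr_sumr; apply: eq_bigr => i _.
  rewrite mulr_sumr mulr_sumr; apply: eq_bigr => j _.
  by rewrite mulrCA mulrACA.
ring.
Qed.

Lemma has_mean_weighted_sqr_norm (a : 'I_d -> R) (B : 'I_d -> 'I_d -> R) :
  has_mean P (fun w => (1 + \sum_j u j w ^+ 2) *
      \sum_k (a k + \sum_l B k l * u l w) ^+ 2)
    (d.+1%:R * (\sum_k a k ^+ 2) + (d%:R + kappa) * \sum_k \sum_l B k l ^+ 2).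
Proof.
rewrite [X in has_mean _ _ X](_ : _ = \sum_k (d.+1%:R * a k ^+ 2 +
   (d%:R + kappa) * \sum_l B k l ^+ 2)); last first.
  by rewrite big_split/= !mulr_sumr.
apply: (@eq_has_mean _ _ _ _ (fun w => \sum_k ((1 + \sum_j u j w ^+ 2) *
      (a k + \sum_l B k l * u l w) ^+ 2))).
  by move=> w; rewrite mulr_sumr.
apply: has_mean_sum => k; apply: has_mean_weighted_affine_sqr.
- rewrite -nat1r; apply: has_meanD; first exact: has_mean_cst.
  have -> : d%:R = \sum_(j < d) 1 :> R by rewrite sumr_const card_ord.
  by apply: has_mean_sum => j; exact: (has_mean_std_moment j (k := 2)).
- move=> l.
  have := has_meanD (has_mean_std_moment l (k := 1) isT)
    (has_mean_sum (index_enum 'I_d) (fun j => has_mean_sqr_linear j l)).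
  rewrite big1// addr0; apply: eq_has_mean => w.
  by rewrite expr1 mulrDl mul1r mulr_suml.
- move=> i l.
  have := has_meanD (has_mean_cross i l)
    (has_mean_sum (index_enum 'I_d) (fun j => has_mean_sqr_cross j i l)).
  rewrite -mulr_sumr -[X in X + _]mulr1 -mulrDr.
  (* The weight's constant term gives 1, the index [j = i] gives [kappa], and the other [d - 1]
     indices give 1 each. *)
  have -> : 1 + \sum_(j < d) (if j == i then kappa else 1) = d%:R + kappa.
    rewrite (bigD1 i)//= eqxx addrCA addrC; congr (_ + _).
    transitivity (\sum_(j < d) (1 : R)); last by rewrite sumr_const card_ord.
    rewrite [RHS](bigD1 i)//=; congr (_ + _).
    by apply: eq_bigr => j /negPf ->.
  by apply: eq_has_mean => w; rewrite mulrDl mul1r mulr_suml.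
Qed.

End moments.

(** * Gradients in the parameters and of the quadratic *)

(** A directional derivative sees only the values along a line. This turns derivatives in [m] or [C]
    into derivatives of [f] at [Tw m C u], although the variables live in different spaces. *)
Lemma eq_derive_along (R : realType) (V W : normedModType R)
    (f : V -> R) (g : W -> R) a v b w :
  (forall h : R, f (h *: v + a) = g (h *: w + b)) -> 'D_v f a = 'D_w g b.
Proof.
move=> fg; have fgab : f a = g b by move: (fg 0); rewrite !scale0r !add0r.
rewrite /derive.
by under eq_fun do rewrite /= fg fgab.
Qed.

Section gradient.
Variables (R : realType) (d : nat).
Implicit Types (f : 'cV[R]_d -> R) (m z u : 'cV[R]_d) (M C : 'M[R]_d).

Lemma sqr_norm2 z : norm2 z ^+ 2 = \sum_i z i 0 ^+ 2.
Proof. by rewrite sqr_sqrtr// sumr_ge0// => i _; rewrite sqr_ge0. Qed.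

Lemma sqr_frob C : frob C ^+ 2 = \sum_i \sum_j C i j ^+ 2.
Proof.
by rewrite sqr_sqrtr// !sumr_ge0// => i _; rewrite sumr_ge0// => j _; rewrite sqr_ge0.
Qed.

Lemma grad_mE f m C u : grad_m f m C u = grad f (Tw m C u).
Proof.
apply/matrixP => i j; rewrite !mxE.
by apply: eq_derive_along => h; rewrite /Tw addrCA.
Qed.

(** Moving entry [(i, j)] of [C] by [h] moves [Tw m C u] by [h * u_j] along the [i]-th basis vector;
    differentiability makes the derivative linear in the direction, which pulls out [u_j]. *)
Lemma grad_CE f m C u : differentiable f (Tw m C u) ->
  grad_C f m C u = grad f (Tw m C u) *m u^T.
Proof.
move=> df; apply/matrixP => i j; rewrite !mxE big_ord1 !mxE.
transitivity ('D_(u j 0 *: (delta_mx i 0 : 'cV[R]_d)) f (Tw m C u)).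
  apply: eq_derive_along => h.
  congr f; rewrite /Tw /= mulmxDl -addrA; congr (_ + _).
  rewrite -scalemxAl; congr (_ *: _).
  apply/matrixP => a b; rewrite !mxE !ord1 eqxx andbT.
  rewrite (bigD1 j)//= big1 ?addr0; last first.
    by move=> k /negPf kj; rewrite !mxE kj andbF mul0r.
  by rewrite mxE eqxx andbT mulrC.
by rewrite !deriveE// linearZ /= mulrC.
Qed.

Lemma sqr_gradw_norm f m C u : differentiable f (Tw m C u) ->
  gradw_norm f m C u ^+ 2 =
  (1 + \sum_j u j 0 ^+ 2) * norm2 (grad f (Tw m C u)) ^+ 2.
Proof.
move=> df; rewrite sqr_sqrtr; last first.
  by rewrite addr_ge0// !sumr_ge0// => i _; rewrite ?sumr_ge0// => *; rewrite sqr_ge0.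
rewrite grad_mE grad_CE// sqr_norm2 mulrDl mul1r; congr (_ + _).
(* The matrix part has rank one, so its squared Frobenius norm is the product of the two squared
   vector norms. *)
rewrite mulr_suml exchange_big/=; apply: eq_bigr => j _.
rewrite mulr_sumr; apply: eq_bigr => i _.
by rewrite mxE big_ord1 [u^T _ _]mxE exprMn mulrC.
Qed.

Lemma quadE M zbar z : quad M zbar z =
  2^-1 * \sum_i \sum_j (z i 0 - zbar i 0) * M i j * (z j 0 - zbar j 0).
Proof.
rewrite /quad; congr (_ * _); rewrite mxE exchange_big/=; apply: eq_bigr => j _.
rewrite !mxE mulr_suml; apply: eq_bigr => i _.
by rewrite !mxE.
Qed.

Lemma differentiable_quad M zbar z : differentiable (quad M zbar) z.
Proof.
(* Exhibit [quad] as a polynomial in the coordinate functions, so that the sum and product rules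
   apply. *)
have -> : quad M zbar = (cst 2^-1 : 'cV[R]_d -> R) * \sum_i \sum_j
    (((fun z : 'cV[R]_d => z i 0) - cst (zbar i 0)) * cst (M i j)
      * ((fun z : 'cV[R]_d => z j 0) - cst (zbar j 0))).
  apply/funext => x; rewrite quadE /= mulrfctE/=; congr (_ * _).
  rewrite fct_sumE; apply: eq_bigr => i _; rewrite fct_sumE; apply: eq_bigr => j _.
  by [].
have dc i : differentiable ((fun z : 'cV[R]_d => z i 0) - cst (zbar i 0)) z.
  by apply: differentiableB => //; exact: differentiable_coord.
apply: differentiableM => //.
apply: differentiable_sum => i; apply: differentiable_sum => j.
by apply: differentiableM => //; apply: differentiableM.
Qed.

Lemma grad_quad M zbar z : M^T = M -> grad (quad M zbar) z = M *m (z - zbar).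
Proof.
move=> MT; apply/matrixP => i j; rewrite ord1 [LHS]mxE {j}.
set e : 'cV[R]_d := delta_mx i 0; set c := (M *m (z - zbar)) i 0.
(* The increment along [e] is an exact quadratic in [h], so the difference quotient is affine in [h]
   with value [c] at 0. *)
have quadD h : quad M zbar (h *: e + z) - quad M zbar z =
    h * (c + h * (2^-1 * M i i)).
  rewrite /quad -addrA; set y := z - zbar.
  have E1 : e^T *m M *m y = c%:M.
    rewrite /e trmx_delta -rowE; apply/matrixP => a b; rewrite !ord1 /c !mxE.
    by apply: eq_bigr => k _; rewrite mxE.
  (* Symmetry of [M] makes the two cross terms equal, which cancels the factor one half. *)
  have E2 : y^T *m M *m e = c%:M.
    by apply: trmx_inj; rewrite !trmx_mul trmxK MT mulmxA E1 tr_scalar_mx.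
  have E3 : e^T *m M *m e = (M i i)%:M.
    rewrite /e trmx_delta -rowE -colE; apply/matrixP => a b; rewrite !ord1 !mxE.
    by rewrite eqxx.
  clearbody y.
  have -> : (h *: e + y)^T = h *: e^T + y^T by rewrite linearD linearZ.
  rewrite !(mulmxDl, mulmxDr) -!scalemxAl -!scalemxAr.
  rewrite E1 E2 E3 !mxE !eqxx /=; by field.
apply: cvg_lim => //.
apply: (@cvg_trans _ ((fun h : R => c + h * (2^-1 * M i i)) @ 0^')).
  apply: near_eq_cvg; near=> h.
  have h0 : h != 0 by near: h; exact: nbhs_dnbhs_neq.
  by rewrite /= quadD -[RHS]/(h^-1 * _) mulKf.
apply: cvg_within_filter.
suff : c + h * (2^-1 * M i i) @[h --> (0 : R)] --> c + 0 * (2^-1 * M i i).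
  by rewrite mul0r addr0.
apply: cvgD; first exact: cvg_cst.
by apply: cvgM; [exact: cvg_id|exact: cvg_cst].
Unshelve. all: by end_near. Qed.

End gradient.

(** * The dominating integrand and the conclusion *)

(** This integrand majorizes the squared gradient norm for a general smooth [f] and equals it for
    the quadratic, so its mean settles both halves of the theorem. *)
Lemma has_mean_dominating {dd : measure_display} {T : measurableType dd}
    {R : realType} (P : probability T R) (d : nat) (u : 'I_d -> {RV P >-> R})
    (kappa : R) (M C : 'M[R]_d) (m zbar : 'cV[R]_d) :
  standardized_kappa u kappa ->
  has_mean P (fun w => (1 + \sum_j rvec u w j 0 ^+ 2) *
      norm2 (M *m (Tw m C (rvec u w) - zbar)) ^+ 2)
    (d.+1%:R * norm2 (M *m (m - zbar)) ^+ 2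
      + (d%:R + kappa) * frob (M *m C) ^+ 2).
Proof.
move=> std_u; rewrite !sqr_norm2 sqr_frob.
apply: eq_has_mean (has_mean_weighted_sqr_norm std_u
  (fun k => (M *m (m - zbar)) k 0) (fun k l => (M *m C) k l)) => w.
rewrite sqr_norm2; congr ((1 + _) * _); apply: eq_bigr => k _.
  by rewrite mxE.
have -> : M *m (Tw m C (rvec u w) - zbar) =
    M *m (m - zbar) + M *m C *m rvec u w.
  by rewrite -mulmxA -mulmxDr [in RHS]addrC addrA.
rewrite [in RHS]mxE; congr ((_ + _) ^+ 2); rewrite [RHS]mxE.
by apply: eq_bigr => l _; rewrite [rvec _ _ _ _]mxE.
Qed.

Theorem theorem2 :
  (forall (R : realType) (d : nat) (M : 'M[R]_d) (f : 'cV[R]_d -> R)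
      (zbar : 'cV[R]_d) (dd : measure_display) (T : measurableType dd)
      (P : probability T R) (u : 'I_d -> {RV P >-> R}) (kappa : R)
      (m : 'cV[R]_d) (C : 'M[R]_d),
    M^T = M ->
    (forall z, differentiable f z) ->
    matrix_smooth M f ->
    grad f zbar = 0 ->
    standardized_kappa u kappa ->
    (\int[P]_w ((gradw_norm f m C (rvec u w)) ^+ 2)%:E
      <= ((d.+1)%:R * norm2 (M *m (m - zbar)) ^+ 2
          + (d%:R + kappa) * frob (M *m C) ^+ 2)%:E)%E)
  /\
  (forall (R : realType) (d : nat) (M : 'M[R]_d) (zbar : 'cV[R]_d),
    M^T = M ->
    (forall z, differentiable (quad M zbar) z) /\
    matrix_smooth M (quad M zbar) /\
    grad (quad M zbar) zbar = 0 /\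
    (forall (dd : measure_display) (T : measurableType dd)
        (P : probability T R) (u : 'I_d -> {RV P >-> R}) (kappa : R)
        (m : 'cV[R]_d) (C : 'M[R]_d),
      standardized_kappa u kappa ->
      (\int[P]_w ((gradw_norm (quad M zbar) m C (rvec u w)) ^+ 2)%:E
        = ((d.+1)%:R * norm2 (M *m (m - zbar)) ^+ 2
            + (d%:R + kappa) * frob (M *m C) ^+ 2)%:E)%E)).
Proof.
split.
  move=> R d M f zbar dd T P u kappa m C _ df Mf f0 std_u.
  have [_ <-] := has_mean_dominating M C m zbar std_u.
  apply: ge0_le_integralT => w; first by rewrite lee_fin sqr_ge0.
  rewrite lee_fin sqr_gradw_norm//; apply: ler_wpM2l.
    by rewrite addr_ge0// sumr_ge0// => j _; rewrite sqr_ge0.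
  rewrite ler_pXn2r ?nnegrE ?sqrtr_ge0//.
  (* Smoothness is compared against the stationary point, where the gradient vanishes. *)
  by have := Mf (Tw m C (rvec u w)) zbar; rewrite f0 subr0.
move=> R d M zbar MT.
have df := @differentiable_quad R d M zbar.
split=> //; split; [|split].
(* For the quadratic, matrix smoothness holds with equality. *)
- by move=> y z; rewrite !grad_quad// -mulmxBr opprB addrA subrK.
- by rewrite grad_quad// subrr mulmx0.
move=> dd T P u kappa m C std_u.
have [_ <-] := has_mean_dominating M C m zbar std_u.
by apply: eq_integral => w _; rewrite sqr_gradw_norm// grad_quad.
Qed.
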